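(* (a) Suppose that $\mathcal V$ is a congruence modular variety and that $d(x,y,z)$ is a Gumm difference term for $\mathcal V$. Then for all $A\in\mathcal V$, all $\alpha,\beta,\gamma\in\mathrm{Con}(A)$ with $\alpha\wedge\beta\le\gamma$, and all $x,y,z,u,v\in A$ such that $x\,\alpha\,y$, $x\,\beta\,z$, $z\,\alpha\,v$, $z\,\gamma\,u$, $y\,\beta\,u$ and $u\,\beta\,v$, we have $x\,\gamma\,d(u,v,y)$ and $d(u,v,y)\,\beta\,y$. (b) Conversely, suppose $\mathcal V$ is a variety and $d(x,y,z)$ is a ternary term such that for all $A\in\mathcal V$, all $\alpha,\beta,\gamma\in\mathrm{Con}(A)$ with $\alpha\wedge\beta\le\gamma$, and all $x,y,z,u,v\in A$ with $x\,\alpha\,y$, $x\,\beta\,z$, $z\,\alpha\,v$, $z\,\gamma\,u$, $y\,\beta\,u$, $u\,\beta\,v$, we have $x\,\gamma\,d(u,v,y)$ and $d(u,v,y)\,\beta\,y$. Then $\mathcal V$ is congruence modular and $d$ is a Gumm difference term for $\mathcal V$.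
   Context: A Gumm difference term for a variety $\mathcal V$ is a ternary term $d$ such that (i) $d(x,x,y)\approx y$ holds in $\mathcal V$, and (ii) for all $A\in\mathcal V$, $\alpha\in\mathrm{Con}(A)$ and $x,y\in A$ with $x\,\alpha\,y$, we have $d(x,y,y)\,[\alpha,\alpha]\,x$. Here the commutator $[\alpha,\beta]$ of congruences is defined as follows: let $M(\alpha,\beta)$ be the set of $2\times 2$ matrices $\begin{pmatrix} t(\mathbf a^1,\mathbf b^1)& t(\mathbf a^1,\mathbf b^2)\\ t(\mathbf a^2,\mathbf b^1)& t(\mathbf a^2,\mathbf b^2)\end{pmatrix}$ with $t$ an $(m+n)$-ary term, $a^1_i\,\alpha\,a^2_i$ for $i\le m$, $b^1_j\,\beta\,b^2_j$ for $j\le n$; $C(\alpha,\beta;\delta)$ means for every such matrix $t(\mathbf a^1,\mathbf b^1)\,\delta\,t(\mathbf a^1,\mathbf b^2)$ implies $t(\mathbf a^2,\mathbf b^1)\,\delta\,t(\mathbf a^2,\mathbf b^2)$; $[\alpha,\beta]$ is the meet of all $\delta$ with $C(\alpha,\beta;\delta)$. *)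

(* Defs.v *)
From mathcomp Require Import all_boot.

Set Implicit Arguments.
Unset Strict Implicit.
Unset Printing Implicit Defensive.

Record signature := Signature {
  op_sym :> Type;
  arity : op_sym -> nat
}.

Record algebra (S : signature) := Algebra {
  carrier :> Type;
  ops : forall f : S, ('I_(arity f) -> carrier) -> carrier
}.

Inductive term (S : signature) (X : Type) : Type :=
  | Var : X -> term S X
  | App : forall f : S, ('I_(arity f) -> term S X) -> term S X.

Arguments Var {S X} _.
Arguments App {S X} f _.

Fixpoint eval (S : signature) (A : algebra S) (X : Type) (e : X -> A)
  (t : term S X) : A :=
  match t with
  | Var x => e x
  | App f args => @ops S A f (fun i => eval e (args i))
  end.

Definition satisfies (S : signature) (A : algebra S) (s t : term S nat) : Prop :=
  forall e : nat -> A, eval e s = eval e t.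

Definition in_variety (S : signature) (Sigma : term S nat -> term S nat -> Prop)
  (A : algebra S) : Prop :=
  forall s t, Sigma s t -> satisfies A s t.

Definition eval3 (S : signature) (A : algebra S) (d : term S 'I_3) (x y z : A) : A :=
  eval (fun i : 'I_3 => tnth [tuple x; y; z] i) d.

Definition rel_le (A : Type) (r s : A -> A -> Prop) : Prop :=
  forall x y, r x y -> s x y.

Definition rel_meet (A : Type) (r s : A -> A -> Prop) : A -> A -> Prop :=
  fun x y => r x y /\ s x y.

Definition is_congruence (S : signature) (A : algebra S) (th : A -> A -> Prop) : Prop :=
  [/\ (forall x, th x x),
      (forall x y, th x y -> th y x),
      (forall x y z, th x y -> th y z -> th x z) &
      (forall (f : S) (a b : 'I_(arity f) -> A),
          (forall i, th (a i) (b i)) -> th (@ops S A f a) (@ops S A f b))].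

Definition con_join (S : signature) (A : algebra S) (r s : A -> A -> Prop) : A -> A -> Prop :=
  fun x y => forall th, is_congruence th -> rel_le r th -> rel_le s th -> th x y.

Definition term_cond (S : signature) (A : algebra S) (al be de : A -> A -> Prop) : Prop :=
  forall (m n : nat) (t : term S ('I_m + 'I_n)%type)
         (a1 a2 : 'I_m -> A) (b1 b2 : 'I_n -> A),
    (forall i, al (a1 i) (a2 i)) ->
    (forall j, be (b1 j) (b2 j)) ->
    let tv a b := eval (fun v => match v with inl i => a i | inr j => b j end) t in
    de (tv a1 b1) (tv a1 b2) -> de (tv a2 b1) (tv a2 b2).

Definition commutator (S : signature) (A : algebra S) (al be : A -> A -> Prop) : A -> A -> Prop :=
  fun x y => forall de, is_congruence de -> term_cond al be de -> de x y.

Definition congruence_modular (S : signature) (Sigma : term S nat -> term S nat -> Prop) : Prop :=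
  forall A : algebra S, in_variety Sigma A ->
  forall al be ga : A -> A -> Prop,
    is_congruence al -> is_congruence be -> is_congruence ga ->
    rel_le al ga ->
    rel_le (rel_meet (con_join be al) ga) (con_join al (rel_meet be ga)).

Definition gumm_difference_term (S : signature) (Sigma : term S nat -> term S nat -> Prop)
  (d : term S 'I_3) : Prop :=
  (forall A : algebra S, in_variety Sigma A -> forall x y : A, eval3 d x x y = y) /\
  (forall A : algebra S, in_variety Sigma A ->
   forall al : A -> A -> Prop, is_congruence al ->
   forall x y : A, al x y -> commutator al al (eval3 d x y y) x).

Definition shift_condition (S : signature) (Sigma : term S nat -> term S nat -> Prop)
  (d : term S 'I_3) : Prop :=
  forall A : algebra S, in_variety Sigma A ->
  forall al be ga : A -> A -> Prop,
    is_congruence al -> is_congruence be -> is_congruence ga ->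
    rel_le (rel_meet al be) ga ->
  forall x y z u v : A,
    al x y -> be x z -> al z v -> ga z u -> be y u -> be u v ->
    ga x (eval3 d u v y) /\ be (eval3 d u v y) y.

(* Main.v *)
(** A congruence [be] of [A], or any compatible reflexive relation, is viewed as
    a subalgebra [B] of [A * A] on whose elements the hypotheses are applied.
    The term condition [C(al, be; de)] says that the diagonal pairs [(x, x)] and
    [(y, y)], [x al y], are congruent modulo the largest congruence of [B] that
    saturates [de]; call it [Th].  The shifting lemma shows that [Th] meets the
    kernel of the first projection below the kernel of the second modulo [de],
    from which [C] is symmetric in its first two arguments and monotone in the
    third.

    For (a) this gives [C(th, th; ph)] with [th = (al v be) ^ (be v ga)] and
    [ph = be v (al ^ ga)], hence [d(u,x,x) ph u]; then [x ga d(u,z,x)], and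
    [d(u,z,x)] and [d(u,v,y)] are related by [al ^ ph <= ga].

    For (b), taking [u = v] gives the shifting lemma.  To get modularity from
    it, write [be v al] as the union of the tolerances [L(n+1) = L(n) G L(n)],
    [L(0) = be], [G = al v (be ^ ga)]; the shifting lemma in the algebra [L(n)]
    gives [ga ^ L(n) <= G] inductively.  The commutator identity is the shift
    condition in [B = al] at the points [(x,x), (y,y), (x,x), (y,x), (y,y)]. *)

Require Import Defs.
From mathcomp Require Import all_boot.
From Stdlib Require Import FunctionalExtensionality ProofIrrelevance.
From Stdlib Require Import Relation_Operators Operators_Properties.

Set Implicit Arguments.
Unset Strict Implicit.
Unset Printing Implicit Defensive.

(** * Terms and compatible relations *)

Section Terms.
Variable S : signature.

Fixpoint subst (X Y : Type) (s : X -> term S Y) (t : term S X) : term S Y :=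
  match t with
  | Var x => s x
  | App f args => App f (fun i => subst s (args i))
  end.

Lemma eval_subst (A : algebra S) (X Y : Type) (e : Y -> A) (s : X -> term S Y) t :
  eval e (subst s t) = eval (fun x => eval e (s x)) t.
Proof.
elim: t => //= f args IH; congr ops.
by apply: functional_extensionality => i; exact: IH.
Qed.

Lemma eq_eval (A : algebra S) (X : Type) (e1 e2 : X -> A) t :
  e1 =1 e2 -> eval e1 t = eval e2 t.
Proof. by move=> /functional_extensionality ->. Qed.

Definition compatible (A : algebra S) (R : A -> A -> Prop) : Prop :=
  forall (f : S) (a b : 'I_(arity f) -> A),
    (forall i, R (a i) (b i)) -> R (@ops S A f a) (@ops S A f b).

Lemma compatible_eval (A : algebra S) (R : A -> A -> Prop) (X : Type)
    (e1 e2 : X -> A) t :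
  compatible R -> (forall x, R (e1 x) (e2 x)) -> R (eval e1 t) (eval e2 t).
Proof. by move=> cR He; elim: t => //= f args IH; apply: cR. Qed.

Definition update (n : nat) (A : Type) (a : 'I_n -> A) (i : 'I_n) (y : A) :=
  fun j => if j == i then y else a j.

(** Arguments are replaced one at a time from left to right, and transitivity composes the steps. *)
Lemma compatible_update (A : algebra S) (R : A -> A -> Prop) :
    (forall x, R x x) -> (forall x y z, R x y -> R y z -> R x z) ->
    (forall (f : S) (a : 'I_(arity f) -> A) i y,
        R (a i) y -> R (@ops S A f a) (@ops S A f (update a i y))) ->
  compatible R.
Proof.
move=> Rxx Rtr Rup f a b Rab.
pose g k := fun i : 'I_(arity f) => if i < k then b i else a i.
have Rg k : k <= arity f -> R (@ops S A f a) (@ops S A f (g k)).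
  elim: k => [_|k IH lt_k].
    suff -> : g 0 = a by [].
    exact: functional_extensionality.
  apply: Rtr (IH (ltnW lt_k)) _.
  suff -> : g k.+1 = update (g k) (Ordinal lt_k) (b (Ordinal lt_k)).
    by apply: Rup; rewrite /g ltnn.
  apply: functional_extensionality => i; rewrite /g /update ltnS leq_eqVlt -val_eqE /=.
  by case: eqP => //= Ei; congr b; apply: val_inj.
suff <- : g (arity f) = b by apply: Rg.
by apply: functional_extensionality => i; rewrite /g ltn_ord.
Qed.

End Terms.

(** * Congruences *)

Section Congruences.
Variables (S : signature) (A : algebra S).
Implicit Types r s th : A -> A -> Prop.

Lemma cong_refl th : is_congruence th -> forall x, th x x.
Proof. by case. Qed.

Lemma cong_sym th : is_congruence th -> forall x y, th x y -> th y x.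
Proof. by case. Qed.

Lemma cong_trans th : is_congruence th -> forall y x z, th x y -> th y z -> th x z.
Proof. by case=> _ _ tr _ y x z; apply: tr. Qed.

Lemma cong_compatible th : is_congruence th -> compatible th.
Proof. by case. Qed.

Lemma cong_eval3 th d x x' y y' z z' : is_congruence th ->
  th x x' -> th y y' -> th z z' -> th (eval3 d x y z) (eval3 d x' y' z').
Proof.
move=> cth xx yy zz; apply: (compatible_eval _ (cong_compatible cth)).
by case=> [[|[|[|]]]].
Qed.

Lemma cong_eq : is_congruence (@eq A).
Proof.
split=> // [x y z -> //|f a b Eab]; congr ops.
exact: functional_extensionality.
Qed.

Lemma cong_total : is_congruence (fun _ _ : A => True).
Proof. by []. Qed.

Lemma cong_meet r s :
  is_congruence r -> is_congruence s -> is_congruence (rel_meet r s).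
Proof.
move=> [r1 r2 r3 r4] [s1 s2 s3 s4]; split.
- by [].
- by move=> x y [/r2 ? /s2].
- by move=> x y z [rxy sxy] [ryz syz]; split; [apply: r3 ryz|apply: s3 syz].
- by move=> f a b ab; split; [apply: r4|apply: s4] => i; case: (ab i).
Qed.

Lemma cong_join r s : is_congruence (con_join r s).
Proof.
split.
- by move=> x th [].
- by move=> x y jxy th cth rth sth; apply: cong_sym => //; apply: jxy.
- move=> x y z jxy jyz th cth rth sth.
  by apply: (cong_trans cth (y := y)); [apply: jxy|apply: jyz].
- by move=> f a b jab th cth rth sth; apply: cong_compatible => // i; apply: jab.
Qed.

Lemma join_l r s : rel_le r (con_join r s).
Proof. by move=> x y rxy th _ le_r _; apply: le_r. Qed.

Lemma join_r r s : rel_le s (con_join r s).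
Proof. by move=> x y sxy th _ _ le_s; apply: le_s. Qed.

Lemma join_le r s th : is_congruence th -> rel_le r th -> rel_le s th ->
  rel_le (con_join r s) th.
Proof. by move=> cth rth sth x y; apply. Qed.

Lemma join_chain r s x y : is_congruence r -> is_congruence s ->
  con_join r s x y -> clos_refl_trans A (fun x y => r x y \/ s x y) x y.
Proof.
(* The join lies below every congruence above [r] and [s]; it remains to see that the chain relation
   is one. *)
move=> cr cs; apply.
- split.
  + by move=> u; apply: rt_refl.
  + move=> u v; elim=> [{}u {}v uv|{}u|{}u w {}v _ ? _ ?].
    * by apply: rt_step; case: uv => /cong_sym; [left|right]; auto.
    * exact: rt_refl.
    * by apply: rt_trans; eassumption.
  + by move=> u v w; apply: rt_trans.
  + apply: compatible_update => [u|u v w|f a i v].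
    * exact: rt_refl.
    * exact: rt_trans.
    (* The translation [b] preserves [r]-steps and [s]-steps, hence chains. *)
    * pose b w := @ops S A f (update a i w).
      have -> : ops a = b (a i).
        congr ops; apply: functional_extensionality => j; rewrite /update.
        by case: eqP => // ->.
      rewrite -/(b v); elim=> [{}u {}v uv|{}u|{}u w {}v _ ? _ ?].
      - apply: rt_step; case: uv => uv; [left|right].
          apply: (cong_compatible cr) => j; rewrite /update.
          by case: ifP => // _; apply: cong_refl.
        apply: (cong_compatible cs) => j; rewrite /update.
        by case: ifP => // _; apply: cong_refl.
      - exact: rt_refl.
      - by apply: rt_trans; eassumption.
- by move=> u v uv; apply: rt_step; left.
- by move=> u v uv; apply: rt_step; right.
Qed.

End Congruences.

(** * Binary subpowers *)

Record rel_pair (T : Type) (R : T -> T -> Prop) := RelPair {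
  pr1 : T;
  pr2 : T;
  pr_rel : R pr1 pr2
}.

Section PairAlgebra.
Variables (S : signature) (A : algebra S) (R : A -> A -> Prop).
Hypothesis cR : compatible R.

Definition pair_algebra : algebra S :=
  @Algebra S (rel_pair R)
    (fun f a => RelPair (cR (fun i => pr_rel (a i)))).
Notation B := pair_algebra.

Lemma rel_pair_eq (P Q : B) : pr1 P = pr1 Q -> pr2 P = pr2 Q -> P = Q.
Proof.
case: P Q => [p1 p2 rp] [q1 q2 rq] /= E1 E2; case: _ / E1 in rq *.
by case: _ / E2 in rq *; congr RelPair; exact: proof_irrelevance.
Qed.

Lemma pr1_eval (X : Type) (e : X -> B) t :
  pr1 (eval e t) = eval (fun x => pr1 (e x)) t.
Proof.
elim: t => //= f args IH; congr ops.
by apply: functional_extensionality => i; exact: IH.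
Qed.

Lemma pr2_eval (X : Type) (e : X -> B) t :
  pr2 (eval e t) = eval (fun x => pr2 (e x)) t.
Proof.
elim: t => //= f args IH; congr ops.
by apply: functional_extensionality => i; exact: IH.
Qed.

Lemma pr2_eval3 d (P Q T : B) :
  pr2 (eval3 d P Q T) = eval3 d (pr2 P) (pr2 Q) (pr2 T).
Proof. by rewrite /eval3 pr2_eval; apply: eq_eval; case=> [[|[|[|]]]]. Qed.

Lemma pair_in_variety Sigma : in_variety Sigma A -> in_variety Sigma B.
Proof.
move=> VA s t st e.
by apply: rel_pair_eq; rewrite ?pr1_eval ?pr2_eval; apply: VA.
Qed.

Definition on1 (r : A -> A -> Prop) : B -> B -> Prop :=
  fun P Q => r (pr1 P) (pr1 Q).
Definition on2 (r : A -> A -> Prop) : B -> B -> Prop :=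
  fun P Q => r (pr2 P) (pr2 Q).

Lemma cong_on1 r : is_congruence r -> is_congruence (on1 r).
Proof.
case=> r1 r2 r3 r4; split=> [P|P Q|P Q T|f a b ab]; rewrite /on1 //; auto.
- exact: r3.
- exact: r4.
Qed.

Lemma cong_on2 r : is_congruence r -> is_congruence (on2 r).
Proof.
case=> r1 r2 r3 r4; split=> [P|P Q|P Q T|f a b ab]; rewrite /on2 //; auto.
- exact: r3.
- exact: r4.
Qed.

End PairAlgebra.

(** * The term condition *)

Section SyntacticCongruence.
Variables (S : signature) (B : algebra S) (D : B -> Prop).

(** Under this environment a term over [unit + Y] is a unary polynomial at [p] with parameters
    [c]. *)
Definition poly_env (Y : Type) (p : B) (c : Y -> B) (v : unit + Y) : B :=
  match v with inl _ => p | inr y => c y end.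

(** The largest congruence of [B] for which [D] is a union of classes. *)
Definition syntactic (p q : B) : Prop :=
  forall (Y : finType) (t : term S (unit + Y)) (c : Y -> B),
    D (eval (poly_env p c) t) <-> D (eval (poly_env q c) t).

Lemma cong_syntactic : is_congruence syntactic.
Proof.
have tr p q r : syntactic p q -> syntactic q r -> syntactic p r.
  by move=> pq qr Y t c; apply: iff_trans (pq Y t c) (qr Y t c).
split=> [//|p q pq Y t c|//|]; first by split=> /(pq Y t c).
apply: compatible_update => // f a i y ay Y t c.
(* The translation is absorbed into the polynomial: the other arguments of [f] become extra
   parameters. *)
pose s (v : unit + Y) : term S (unit + (Y + 'I_(arity f))) :=
  match v with
  | inl _ => App f (fun j => if j == i then Var (inl tt) else Var (inr (inr j)))
  | inr w => Var (inr (inl w))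
  end.
pose c' (w : Y + 'I_(arity f)) := match w with inl w => c w | inr j => a j end.
have Es p : eval (poly_env (ops (update a i p)) c) t
            = eval (poly_env p c') (subst s t).
  rewrite eval_subst; apply: eq_eval => -[[]|w] //=; congr ops.
  by apply: functional_extensionality => j; rewrite /update; case: ifP.
have Ea : a = update a i (a i).
  by apply: functional_extensionality => j; rewrite /update; case: eqP => // ->.
by rewrite {1}Ea !Es; exact: ay.
Qed.

Lemma syntactic_sat p q : syntactic p q -> D p -> D q.
Proof. by move/(_ void (Var (inl tt)) (fun v => match v with end)) => [+ _]. Qed.

End SyntacticCongruence.

Section TermCondition.
Variables (S : signature) (A : algebra S) (be : A -> A -> Prop).
Hypothesis cbe : is_congruence be.
Notation B := (pair_algebra (cong_compatible cbe)).

Definition diag (x : A) : B := RelPair (cong_refl cbe x).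

Definition centrality (de : A -> A -> Prop) : B -> B -> Prop :=
  syntactic (fun P : B => de (pr1 P) (pr2 P)).

Lemma cong_centrality de : is_congruence (centrality de).
Proof. exact: cong_syntactic. Qed.

(** A polynomial of [B] at [diag u] is a matrix row, with one [al]-variable set to [u] and the
    parameters as [be]-pairs; the term condition carries [de] from row [u] to row [v]. *)
Lemma term_cond_diag al de x y : is_congruence al ->
  term_cond al be de -> al x y -> centrality de (diag x) (diag y).
Proof.
move=> cal tc; have imp u v (Y : finType) (t : term S (unit + Y)) (c : Y -> B) :
    al u v ->
    de (pr1 (eval (poly_env (diag u) c) t)) (pr2 (eval (poly_env (diag u) c) t)) ->
    de (pr1 (eval (poly_env (diag v) c) t)) (pr2 (eval (poly_env (diag v) c) t)).
  move=> uv.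
  pose s (w : unit + Y) : term S ('I_1 + 'I_#|Y|) :=
    match w with inl _ => Var (inl ord0) | inr y => Var (inr (enum_rank y)) end.
  have := tc _ _ (subst s t) (fun=> u) (fun=> v) (fun j => pr1 (c (enum_val j)))
    (fun j => pr2 (c (enum_val j))) (fun=> uv) (fun j => pr_rel _).
  rewrite /= !eval_subst !pr1_eval !pr2_eval => tcE duv.
  have ev (w : A) (pr : B -> A) : pr (diag w) = w ->
      eval (fun v => pr (poly_env (diag w) c v)) t =
      eval (fun v0 => eval (fun v => match v with
         | inl _ => w | inr j => pr (c (enum_val j)) end) (s v0)) t.
    by move=> Ew; apply: eq_eval => -[[]|k] //=; rewrite enum_rankK.
  rewrite (ev v (@pr1 _ _)) // (ev v (@pr2 _ _)) //; apply: tcE.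
  by rewrite (ev u (@pr1 _ _)) // (ev u (@pr2 _ _)) // in duv.
by move=> xy Y t c; split; apply: imp => //; apply: cong_sym.
Qed.

(** This pullback of [centrality de] along the diagonal embedding is the centralizer of [be] modulo
    [de]: the largest [al] with [term_cond al be de]. *)
Lemma cong_centralizer de :
  is_congruence (fun x y => centrality de (diag x) (diag y)).
Proof.
have cT := cong_centrality de; split.
- by move=> u; apply: (cong_refl cT).
- by move=> u v; apply: (cong_sym cT).
- by move=> u v w; apply: (cong_trans cT).
- move=> f a b ab; have := cong_compatible cT ab.
  by congr centrality; apply: rel_pair_eq.
Qed.

(** The rows are values of [t] in [B], at diagonal pairs for the [al]-variables and at the pairs
    [(b1 j, b2 j)] for the others. *)
Lemma centrality_matrix al de m n (t : term S ('I_m + 'I_n)) a1 a2 b1 b2 :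
    (forall x y, al x y -> centrality de (diag x) (diag y)) ->
    (forall i, al (a1 i) (a2 i)) -> (forall j, be (b1 j) (b2 j)) ->
    let tv a b := eval (fun v => match v with inl i => a i | inr j => b j end) t in
  exists P Q : B,
    [/\ centrality de P Q /\ centrality de (diag (pr1 P)) (diag (pr1 Q)),
        pr1 P = tv a1 b1, pr2 P = tv a1 b2, pr1 Q = tv a2 b1 & pr2 Q = tv a2 b2].
Proof.
move=> Hal Ha Hb tv.
pose e (a : 'I_m -> A) (v : 'I_m + 'I_n) : B :=
  match v with inl i => diag (a i) | inr j => RelPair (Hb j) end.
exists (eval (e a1) t), (eval (e a2) t); split.
- split.
    apply: compatible_eval; first exact: cong_compatible (cong_centrality de).
    case=> [i|j] /=; first exact: Hal.
    exact: (cong_refl (cong_centrality de)).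
  rewrite !pr1_eval; apply: (compatible_eval _ (cong_compatible (cong_centralizer de))).
  case=> [i|j] /=; first exact: Hal.
  exact: (cong_refl (cong_centrality de)).
all: by rewrite ?pr1_eval ?pr2_eval; apply: eq_eval; case.
Qed.

Lemma diag_term_cond al de :
  (forall x y, al x y -> centrality de (diag x) (diag y)) -> term_cond al be de.
Proof.
move=> Hal m n t a1 a2 b1 b2 Ha Hb /=.
have [P [Q [[PQ _] <- <- <- <-]]] := centrality_matrix t Hal Ha Hb.
exact: (syntactic_sat PQ).
Qed.

Lemma term_cond_join al1 al2 de : is_congruence al1 -> is_congruence al2 ->
  term_cond al1 be de -> term_cond al2 be de -> term_cond (con_join al1 al2) be de.
Proof.
move=> c1 c2 t1 t2; apply: diag_term_cond => x y.
apply: (join_le (cong_centralizer de)) => u v uv.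
  exact: term_cond_diag t1 uv.
exact: term_cond_diag t2 uv.
Qed.

End TermCondition.

Section TermConditionBasics.
Variables (S : signature) (A : algebra S).
Implicit Types al be de : A -> A -> Prop.

Lemma term_cond_mono al al' be be' de : rel_le al al' -> rel_le be be' ->
  term_cond al' be' de -> term_cond al be de.
Proof. by move=> la lb tc m n t a1 a2 b1 b2 Ha Hb; apply: tc; auto. Qed.

Lemma term_cond_le al be de : is_congruence be -> is_congruence de ->
  rel_le al de -> term_cond al be de.
Proof.
move=> cbe cde le m n t a1 a2 b1 b2 Ha Hb /= H.
have E b : de (eval (fun v => match v with inl i => a1 i | inr j => b j end) t)
              (eval (fun v => match v with inl i => a2 i | inr j => b j end) t).
  apply: compatible_eval; first exact: cong_compatible.
  by case=> [i|j]; [apply: le|apply: cong_refl].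
by apply: (cong_trans cde) (E b2); apply: (cong_trans cde) H; apply: cong_sym.
Qed.

Lemma term_cond_meet al be : is_congruence al -> is_congruence be ->
  term_cond al be (rel_meet al be).
Proof.
move=> cal cbe m n t a1 a2 b1 b2 Ha Hb /= [Hal _]; split.
  have E b : al (eval (fun v => match v with inl i => a1 i | inr j => b j end) t)
              (eval (fun v => match v with inl i => a2 i | inr j => b j end) t).
    apply: compatible_eval; first exact: cong_compatible.
    by case=> [i|j] //; apply: cong_refl.
  by apply: (cong_trans cal) (E b2); apply: (cong_trans cal) Hal; apply: cong_sym.
apply: compatible_eval; first exact: cong_compatible.
by case=> [i|j] //; apply: cong_refl.
Qed.

End TermConditionBasics.

(** * The shifting lemma and the modular commutator *)

(** Gumm's shifting lemma: in a rectangle with [al]-sides [x y], [z v] and [be]-sides [x z], [y v],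
    [ga] passes from one [al]-side to the other. *)
Definition shifting (S : signature) (Sigma : term S nat -> term S nat -> Prop) : Prop :=
  forall A : algebra S, in_variety Sigma A ->
  forall al be ga : A -> A -> Prop,
    is_congruence al -> is_congruence be -> is_congruence ga ->
    rel_le (rel_meet al be) ga ->
  forall x y z v : A, al x y -> al z v -> be x z -> be y v -> ga z v -> ga x y.

Section Shifting.
Variables (S : signature) (Sigma : term S nat -> term S nat -> Prop).

(** The path [x], [z], [v], [y] puts [(x, y)] in [(be v (ga ^ al)) ^ al], which modularity bounds by
    [(ga ^ al) v (be ^ al) <= ga]. *)
Lemma modular_shifting : congruence_modular Sigma -> shifting Sigma.
Proof.
move=> mod A VA al be ga cal cbe cga le x y z v xy zv xz yv gzv.
have cga' := cong_meet cga cal.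
apply: (join_le (r := rel_meet ga al) (s := rel_meet be al)) => //.
- by move=> ? ? [].
- by move=> ? ? [? ?]; apply: le.
apply: (mod A VA) => //; first by move=> ? ? [].
have cj := cong_join be (rel_meet ga al).
split=> //; apply: (cong_trans cj (y := z)); first exact: join_l.
apply: (cong_trans cj (y := v)); first exact: join_r.
by apply: join_l; apply: cong_sym.
Qed.

Hypothesis shift : shifting Sigma.
Variables (A : algebra S).
Hypothesis VA : in_variety Sigma A.

(** Shifting [T] from [(x, y), (x, y')] to [(y, y), (y, y')] and saturating from [de y y] gives
    [de y y']. *)
Lemma centrality_kernel be de (cbe : is_congruence be) : is_congruence de ->
  rel_le (rel_meet (@centrality S A be cbe de) (on1 (cR:=_) (@eq A))) (on2 (cR:=_) de).
Proof.
move=> cde [x y xy] [x' y' xy'] [T Ex]; rewrite /on1 /= in Ex; subst x'.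
have yy' : be y y' by apply: (cong_trans cbe _ xy'); apply: cong_sym.
pose B := pair_algebra (cong_compatible cbe).
have VB : in_variety Sigma B by apply: pair_in_variety.
apply: (@syntactic_sat S B (fun P => de (pr1 P) (pr2 P)) (diag cbe y) (RelPair yy')
  _ (cong_refl cde y)).
apply: (shift VB (cong_on1 _ (cong_eq A)) (cong_on2 _ (cong_eq A))
   (cong_centrality cbe de) _ _ _ _ _ T) => // P Q [E1 E2].
by rewrite (rel_pair_eq E1 E2); apply: (cong_refl (cong_centrality cbe de)).
Qed.

(** In [B], [ph] on second coordinates is shifted from [(p, p), P] to [(q, q), Q], where [p], [q]
    are the first coordinates of the rows [P], [Q]. *)
Lemma term_cond_up (al be de ph : A -> A -> Prop) : is_congruence al -> is_congruence be ->
    is_congruence de -> is_congruence ph ->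
  rel_le de ph -> term_cond al be de -> term_cond al be ph.
Proof.
move=> cal cbe cde cph le tc m n t a1 a2 b1 b2 Ha Hb /=.
pose B := pair_algebra (cong_compatible cbe).
have VB : in_variety Sigma B by apply: pair_in_variety.
have Hal x y := @term_cond_diag S A be cbe al de x y cal tc.
have [P [Q [[PQ dPQ] <- <- <- <-]]] := centrality_matrix t Hal Ha Hb.
have cT := cong_centrality cbe de.
apply: (@shift B VB _ _ _ (cong_on1 _ (cong_eq A)) cT (cong_on2 _ cph) _
  (diag cbe (pr1 Q)) Q (diag cbe (pr1 P)) P) => //.
- move=> U V [E T]; apply: le; apply: (centrality_kernel cde); split; eassumption.
- exact: (cong_sym cT).
- exact: (cong_sym cT).
Qed.

(** For the rows [P], [Q] of the transposed matrix, [de] on second coordinates is shifted from the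
    diagonal pairs over their first coordinates to [P], [Q]. *)
Lemma term_cond_sym (al be de : A -> A -> Prop) : is_congruence al -> is_congruence be ->
  is_congruence de -> term_cond al be de -> term_cond be al de.
Proof.
move=> cal cbe cde tc m n t a1 a2 b1 b2 Ha Hb /=.
pose B := pair_algebra (cong_compatible cbe).
have VB : in_variety Sigma B by apply: pair_in_variety.
have Hal x y := @term_cond_diag S A be cbe al de x y cal tc.
pose s (v : 'I_m + 'I_n) : term S ('I_n + 'I_m) :=
  match v with inl i => Var (inr i) | inr j => Var (inl j) end.
have Es (a : 'I_m -> A) (b : 'I_n -> A) :
    eval (fun v => match v with inl i => a i | inr j => b j end) t =
    eval (fun v => match v with inl i => b i | inr j => a j end) (subst s t).
  by rewrite eval_subst; apply: eq_eval; case.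
have [P [Q [[PQ dPQ]]]] := centrality_matrix (subst s t) Hal Hb Ha.
rewrite /= -!Es => <- <- <- <- dePQ.
have cT := cong_centrality cbe de.
apply: (@shift B VB _ _ _ (cong_meet cT (cong_on1 _ cde))
  (cong_on1 _ (cong_eq A)) (cong_on2 _ cde) _
  P Q (diag cbe (pr1 P)) (diag cbe (pr1 Q))) => //.
by move=> U V [[T _] E]; apply: (centrality_kernel cde); split; eassumption.
Qed.

End Shifting.

(** * From Gumm difference terms to the shift condition *)

Section Direct.
Variables (S : signature) (Sigma : term S nat -> term S nat -> Prop).
Hypothesis mod : congruence_modular Sigma.
Variables (A : algebra S) (al be ga : A -> A -> Prop).
Hypotheses (VA : in_variety Sigma A) (cal : is_congruence al)
  (cbe : is_congruence be) (cga : is_congruence ga).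

(** Starting from [C(al, ga; al ^ ga)], raise the third argument to [ph], then use symmetry and
    joins with [C(be, _; ph)] to reach [C(al v be, be v ga; ph)]. *)
Lemma term_cond_shift :
  let th := rel_meet (con_join be ga) (con_join al be) in
  term_cond th th (con_join be (rel_meet al ga)).
Proof.
move=> th; set ph := con_join be (rel_meet al ga).
have shift := modular_shifting mod.
have cph : is_congruence ph by apply: cong_join.
have cbg : is_congruence (con_join be ga) by apply: cong_join.
have cag : is_congruence (rel_meet al ga) by apply: cong_meet.
have tga : term_cond ga al ph.
  apply: (term_cond_sym shift VA) => //.
  apply: (term_cond_up shift VA _ _ cag) => //.
    exact: join_r.
  exact: term_cond_meet.
have tbe r : is_congruence r -> term_cond be r ph.
  by move=> cr; apply: term_cond_le => //; apply: join_l.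
have t1 : term_cond al (con_join be ga) ph.
  apply: (term_cond_sym shift VA) => //.
  exact: (term_cond_join cal cbe cga (tbe _ cal) tga).
have t2 : term_cond (con_join al be) (con_join be ga) ph.
  exact: (term_cond_join cbg cal cbe t1 (tbe _ cbg)).
by apply: term_cond_mono t2 => x y [].
Qed.

End Direct.

Lemma gumm_shift_condition S (Sigma : term S nat -> term S nat -> Prop) d :
  congruence_modular Sigma -> gumm_difference_term Sigma d -> shift_condition Sigma d.
Proof.
move=> mod [dxxy dxyy] A VA al be ga cal cbe cga le x y z u v xy xz zv zu yu uv.
have dbe : be (eval3 d u v y) y.
  rewrite -{2}(dxxy A VA u y); apply: cong_eval3 => //; try exact: cong_refl.
  exact: cong_sym.
split=> //.
pose th := rel_meet (con_join be ga) (con_join al be).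
pose ph := con_join be (rel_meet al ga).
have cbg := cong_join be ga; have cab := cong_join al be.
have cph : is_congruence ph by apply: cong_join.
have cth : is_congruence th by apply: cong_meet.
have thux : th u x.
  split.
    apply: (cong_trans cbg (y := z)); first by apply: join_r; apply: cong_sym.
    by apply: join_l; apply: cong_sym.
  apply: (cong_trans cab (y := y)); first by apply: join_r; apply: cong_sym.
  by apply: join_l; apply: cong_sym.
have phux : ph (eval3 d u x x) u.
  exact: (dxyy A VA th cth u x thux ph cph (term_cond_shift mod VA cal cbe cga)).
have xd : ga x (eval3 d u z x).
  rewrite -{1}(dxxy A VA z x); apply: cong_eval3 => //; exact: cong_refl.
apply: (cong_trans cga xd).
pose r := rel_meet ga al.
(* The modular law is applied to [(be v (ga ^ al)) ^ al]; the [be v (ga ^ al)] part is the path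
   [d(u,z,x)], [d(u,x,x)], [u], [y], [d(u,v,y)]. *)
apply: (join_le (r := r) (s := rel_meet be al)) => //.
- by move=> ? ? [].
- by move=> ? ? [? ?]; apply: le.
apply: (mod A VA) => //; first exact: cong_meet.
- by move=> ? ? [].
split; last by apply: cong_eval3 => //; exact: cong_refl.
have cj := cong_join be r.
apply: (cong_trans cj (y := eval3 d u x x)).
  by apply: join_l; apply: cong_eval3 => //; [exact: cong_refl|exact: cong_sym|exact: cong_refl].
apply: (cong_trans cj (y := u)).
  apply: (join_le cj _ _ phux); first exact: join_l.
  by move=> ? ? [? ?]; apply: join_r.
apply: join_l; apply: (cong_trans cbe (y := y)); exact: cong_sym.
Qed.

(** * From the shift condition to Gumm difference terms *)

Section Converse.
Variables (S : signature) (Sigma : term S nat -> term S nat -> Prop) (d : term S 'I_3).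
Hypothesis shd : shift_condition Sigma d.

(** Take [al] and [ga] to be equality and [be] total, at the points [y, y, x, x, x]. *)
Lemma shift_condition_xxy (A : algebra S) (x y : A) :
  in_variety Sigma A -> eval3 d x x y = y.
Proof.
move=> VA; apply/esym.
by have [] := @shd A VA _ _ _ (cong_eq A) (cong_total A) (cong_eq A) _ y y x x x => // ? ? [].
Qed.

Lemma shift_condition_shifting : shifting Sigma.
Proof.
move=> A VA al be ga cal cbe cga le x y z v xy zv xz yv gzv.
rewrite -(shift_condition_xxy v y VA).
by have [] := shd VA cal cbe cga le xy xz zv gzv yv (cong_refl cbe v).
Qed.

Lemma shift_condition_commutator (A : algebra S) al : in_variety Sigma A ->
  is_congruence al -> forall x y : A, al x y -> commutator al al (eval3 d x y y) x.
Proof.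
move=> VA cal x y xy de cde tc.
pose B := pair_algebra (cong_compatible cal).
have VB : in_variety Sigma B by apply: pair_in_variety.
have dxy := term_cond_diag (cbe := cal) cal tc xy.
(* The second coordinate of [d((y,x), (y,y), (y,y))] is [d(x,y,y)], and [ga] compares second
   coordinates modulo [de]. *)
have [+ _] := @shd B VB _ _ _ (cong_centrality cal de) (cong_on1 _ (cong_eq A))
  (cong_on2 _ cde) (centrality_kernel shift_condition_shifting VA cde)
  (diag cal x) (diag cal y) (diag cal x) (RelPair (cong_sym cal xy)) (diag cal y)
  dxy erefl dxy (cong_refl cde x) erefl erefl.
by rewrite /on2 pr2_eval3 => /(cong_sym cde).
Qed.

End Converse.

(** * Modularity from the shifting lemma *)

Section ShiftingModular.
Variables (S : signature) (Sigma : term S nat -> term S nat -> Prop).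
Hypothesis shift : shifting Sigma.
Variables (A : algebra S).
Hypothesis VA : in_variety Sigma A.

(** In the algebra of [L]-related pairs the shifting lemma connects [(x, x)] to
    [(y, y)] by a chain inside one class of [ga], so that every pair [(p, q)] of
    the chain satisfies [p G q]. *)
Lemma shifting_principle (L ga G : A -> A -> Prop) x y z w :
    compatible L -> (forall p, L p p) -> is_congruence ga -> is_congruence G ->
    rel_le G ga -> rel_le (rel_meet L ga) G ->
  ga x y -> L x z -> L y w -> G z w -> G x y.
Proof.
move=> cL Lxx cga cG leG leL xy xz yw zw.
pose B := pair_algebra cL.
have VB : in_variety Sigma B by apply: pair_in_variety.
pose C : B -> B -> Prop := rel_meet (on1 ga) (on2 ga).
have cC : is_congruence C by apply: cong_meet; [apply: cong_on1|apply: cong_on2].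
pose r : B -> B -> Prop := rel_meet (on2 G) C.
pose s : B -> B -> Prop := rel_meet C (on1 (@eq A)).
have cr : is_congruence r by apply: cong_meet => //; apply: cong_on2.
have cs : is_congruence s.
  by apply: cong_meet => //; apply: cong_on1; apply: cong_eq.
pose dg p : B := RelPair (Lxx p).
have zw' : ga z w by apply: leG.
have : con_join r s (dg x) (dg y).
  apply: (@shift B VB _ _ _ cC (cong_on1 _ (cong_eq A)) (cong_join r s) _
    (dg x) (dg y) (RelPair xz) (RelPair yw)) => //.
  - by move=> P Q PQ; apply: join_r.
  - by apply: join_l.
move/(join_chain cr cs)/(clos_rt_rt1n _ _ _ _) => H.
have GE (P : B) : ga (pr1 P) (pr2 P) -> G (pr1 P) (pr2 P).
  by move=> gP; apply: leL; split => //; apply: pr_rel.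
have : ga (pr1 (dg x)) (pr2 (dg x)) by apply: cong_refl.
(* Every step lies in [C], so [ga] keeps relating the two coordinates. An [s]-step fixes the first
   coordinate; an [r]-step is crossed by [G] through the second coordinates. *)
suff : forall P Q, clos_refl_trans_1n B (fun u v => r u v \/ s u v) P Q ->
    ga (pr1 P) (pr2 P) -> G (pr1 P) (pr1 Q) by move=> /(_ _ _ H).
move=> P Q; elim=> [{}P _|{}P U {}Q PU _ IH gP]; first exact: cong_refl.
have [C1 C2] : C P U by case: PU => -[].
have gU : ga (pr1 U) (pr2 U).
  apply: (cong_trans cga (y := pr1 P)); first exact: cong_sym.
  by apply: (cong_trans cga gP).
apply: (cong_trans cG) (IH gU).
case: PU => -[]; last by move=> _ ->; apply: cong_refl.
move=> G2 _; apply: (cong_trans cG (GE P gP)); apply: (cong_trans cG G2).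
by apply: cong_sym => //; apply: GE.
Qed.

Fixpoint tolerance (be G : A -> A -> Prop) n : A -> A -> Prop :=
  if n is n'.+1 then fun x y =>
    exists z w, [/\ tolerance be G n' x z, G z w & tolerance be G n' w y]
  else be.

Section Tolerance.
Variables be G : A -> A -> Prop.
Hypotheses (cbe : is_congruence be) (cG : is_congruence G).
Notation L := (tolerance be G).

Lemma tolerance_refl n x : L n x x.
Proof.
elim: n => [|n IH] /=; first exact: cong_refl.
by exists x, x; split=> //; apply: cong_refl.
Qed.

Lemma tolerance_sym n x y : L n x y -> L n y x.
Proof.
elim: n x y => [|n IH] x y /=; first exact: cong_sym.
by move=> [z [w [xz zw wy]]]; exists w, z; split; [exact: IH|exact: cong_sym|exact: IH].
Qed.

Lemma tolerance_compatible n : compatible (L n).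
Proof.
elim: n => [|n IH] /=; first exact: cong_compatible.
move=> f a b /fin_all_exists[z] /fin_all_exists[w] H.
exists (ops z), (ops w).
by split; [apply: IH|apply: cong_compatible|apply: IH] => // i; case: (H i).
Qed.

Lemma tolerance_base n x y : be x y -> L n x y.
Proof.
elim: n => [|n IH] //= xy; exists y, y.
by split; [exact: IH|exact: cong_refl|exact: tolerance_refl].
Qed.

(** Each link prepended to a chain costs one level: a [be]-link goes into the left factor, a
    [G]-link into the middle one. *)
Lemma join_tolerance x y : con_join be G x y -> exists n, L n x y.
Proof.
move/(join_chain cbe cG)/(clos_rt_rt1n _ _ _ _).
elim=> [{}x|{}x z {}y xz _ [n Ln]]; first by exists 0; apply: cong_refl.
exists n.+1; case: xz => xz /=.
  by exists z, z; split=> //; [apply: tolerance_base|apply: cong_refl].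
by exists x, z; split=> //; apply: tolerance_refl.
Qed.

End Tolerance.

End ShiftingModular.

Lemma shifting_modular S (Sigma : term S nat -> term S nat -> Prop) :
  shifting Sigma -> congruence_modular Sigma.
Proof.
move=> shift A VA al be ga cal cbe cga le x y [jxy gxy].
set G := con_join al _.
have cG : is_congruence G by apply: cong_join.
have leG : rel_le G ga by apply: join_le => // ? ? [].
have {jxy} jxy : con_join be G x y.
  apply: join_le jxy; [exact: cong_join|exact: join_l|].
  by move=> u v uv; apply: join_r; apply: join_l.
have [n Ln] := join_tolerance cbe cG jxy.
(* Induction shows [L n ^ ga <= G]; at level 0 this is [be ^ ga <= G]. *)
elim: n => [|n IH] in x y gxy Ln {jxy} *; first by apply: join_r.
have [z [w [xz zw wy]]] := Ln.
have leL : rel_le (rel_meet (tolerance be G n) ga) G.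
  by move=> u v [uv guv]; apply: IH.
exact: (shifting_principle shift VA (tolerance_compatible cbe cG (n := n))
  (tolerance_refl cbe cG n) cga cG leG leL gxy xz (tolerance_sym cbe cG wy) zw).
Qed.

Theorem theorem7p3 (S : signature) (Sigma : term S nat -> term S nat -> Prop)
  (d : term S 'I_3) :
  (congruence_modular Sigma -> gumm_difference_term Sigma d ->
     shift_condition Sigma d) /\
  (shift_condition Sigma d ->
     congruence_modular Sigma /\ gumm_difference_term Sigma d).
Proof.
split; first exact: gumm_shift_condition.
move=> shd; split; first exact: shifting_modular (shift_condition_shifting shd).
split=> A VA; first by move=> x y; exact: (shift_condition_xxy shd x y VA).
by move=> al cal; exact: (shift_condition_commutator shd VA cal).
Qed.
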